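(* Let $K$ be a field and $\lambda\in K$. (1) Let $(C,\Delta,\varepsilon,\alpha_C,\beta_C,\psi_C,\omega_C,\sigma)$ be a coquasitriangular counitary $\lambda$-infBH-bialgebra over $K$, with multiplication $\mu_\sigma$. Let $(M,\rho,\psi_M,\omega_M)$ be a left $(C,\Delta,\psi_C,\omega_C)$-comodule, written $\rho(m)=m_{-1}\otimes m_0$, and let $\alpha_M,\beta_M:M\to M$ be linear maps such that $\beta_M\circ\psi_M=\psi_M\circ\beta_M$ and $\rho\circ\beta_M=(\beta_C\otimes\beta_M)\circ\rho$. Then $(M,\gamma,\rho,\alpha_M,\beta_M,\psi_M,\omega_M)$ becomes a $\lambda$-infBH-Hopf module over $(C,\mu_\sigma,\Delta,\alpha_C,\beta_C,\psi_C,\omega_C)$ with the action $\gamma:C\otimes M\to M$ given by $$\gamma(c\otimes m)=-\sigma(\omega_C(c),m_{-1})\,\beta_M\psi_M^{-1}(m_0),\qquad c\in C,\ m\in M.$$ (2) Let $(C,\Delta,\varepsilon,\alpha_C,\beta_C,\psi_C,\omega_C,\sigma)$ be an anti-coquasitriangular counitary $\lambda$-infBH-bialgebra over $K$, with multiplication $\widetilde{\mu_\sigma}$. Let $(M,\widetilde{\rho},\psi_M,\omega_M)$ be a left $(C,\Delta,\psi_C,\omega_C)$-comodule, written $\widetilde{\rho}(m)=m_{-1}\otimes m_0$, and let $\alpha_M,\beta_M:M\to M$ be linear maps such that $\beta_M\circ\psi_M=\psi_M\circ\beta_M$ and $\widetilde{\rho}\circ\beta_M=(\beta_C\otimes\beta_M)\circ\widetilde{\rho}$.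 Then $(M,\widetilde{\gamma},\widetilde{\rho},\alpha_M,\beta_M,\psi_M,\omega_M)$ becomes a $\lambda$-infBH-Hopf module over $(C,\widetilde{\mu_\sigma},\Delta,\alpha_C,\beta_C,\psi_C,\omega_C)$ with the action $\widetilde{\gamma}:C\otimes M\to M$ given by $$\widetilde{\gamma}(c\otimes m)=-\sigma(\omega_C(c),m_{-1})\,\beta_M\psi_M^{-1}(m_0)-\lambda\,\varepsilon(c)\beta_M(m),\qquad c\in C,\ m\in M.$$ In both formulas $\psi_M^{-1}$ is the inverse of $\psi_M$ (taken to exist).
   Context: A BiHom-associative algebra $(A,\mu,\alpha,\beta)$ consists of a vector space $A$ and linear maps $\mu:A\otimes A\to A$ (written $ab$), $\alpha,\beta:A\to A$ with $\alpha\beta=\beta\alpha$, $\alpha(ab)=\alpha(a)\alpha(b)$, $\beta(ab)=\beta(a)\beta(b)$, $\alpha(a)(bc)=(ab)\beta(c)$. A BiHom-coassociative coalgebra $(C,\Delta,\psi,\omega)$ consists of a vector space $C$ and linear maps $\Delta:C\to C\otimes C$ (written $c_1\otimes c_2$), $\psi,\omega:C\to C$ with $\psi\omega=\omega\psi$, $(\psi\otimes\psi)\Delta=\Delta\psi$, $(\omega\otimes\omega)\Delta=\Delta\omega$, $(\Delta\otimes\psi)\Delta=(\omega\otimes\Delta)\Delta$. It is counitary with counit $\varepsilon:C\to K$ if $\varepsilon\psi=\varepsilon=\varepsilon\omega$, $(\mathrm{id}\otimes\varepsilon)\Delta=\omega$, $(\varepsilon\otimes\mathrm{id})\Delta=\psi$.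 A $\lambda$-infBH-bialgebra $(A,\mu,\Delta,\alpha,\beta,\psi,\omega)$ is a BiHom-associative algebra $(A,\mu,\alpha,\beta)$ that is also a BiHom-coassociative coalgebra $(A,\Delta,\psi,\omega)$, such that each of $\alpha,\beta$ commutes with each of $\psi,\omega$, $(\alpha\otimes\alpha)\Delta=\Delta\alpha$, $(\beta\otimes\beta)\Delta=\Delta\beta$, $\psi$ and $\omega$ are multiplicative, and $\Delta(ab)=\omega(a)b_1\otimes\beta(b_2)+\alpha(a_1)\otimes a_2\psi(b)+\lambda\,\alpha\omega(a)\otimes\beta\psi(b)$. It is counitary if $(A,\Delta,\varepsilon,\psi,\omega)$ is counitary and $\varepsilon\alpha=\varepsilon=\varepsilon\beta$. A coquasitriangular (resp. anti-coquasitriangular) counitary $\lambda$-infBH-bialgebra $(C,\Delta,\varepsilon,\alpha,\beta,\psi,\omega,\sigma)$ consists of a counitary BiHom-coassociative coalgebra $(C,\Delta,\varepsilon,\psi,\omega)$ with $\psi,\omega$ bijective, linear maps $\alpha,\beta:C\to C$ with $\alpha\psi=\psi\alpha$, $\alpha\omega=\omega\alpha$, $\beta\psi=\psi\beta$, $\beta\omega=\omega\beta$, $(\alpha\otimes\alpha)\Delta=\Delta\alpha$, $(\beta\otimes\beta)\Delta=\Delta\beta$, $\varepsilon\alpha=\varepsilon=\varepsilon\beta$, and $\sigma\in(C\otimes C)^*$ with $\sigma\circ(F\otimes F)=\sigma$ for $F\in\{\alpha,\beta,\psi,\omega\}$, such that for all $c,d,e\in C$ $$\sigma(\alpha(c_1),\beta\omega(e))\sigma(c_2,\psi(d))-\sigma(\omega(c),d_1)\sigma(d_2,\psi(e))+\sigma(\omega(d),e_1)\sigma(\alpha\psi(c),\beta(e_2))=\kappa\,\sigma(\alpha(c),\beta(e))\varepsilon(d)$$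 with $\kappa=\lambda$ (resp. $\kappa=-\lambda$). It is regarded as a counitary $\lambda$-infBH-bialgebra $(C,\mu,\Delta,\varepsilon,\alpha,\beta,\psi,\omega)$ with multiplication $\mu=\mu_\sigma$, $\mu_\sigma(c\otimes d)=\alpha\omega^{-1}(c_1)\sigma(c_2,\psi(d))-\sigma(\omega(c),d_1)\beta\psi^{-1}(d_2)-\lambda\alpha(c)\varepsilon(d)$ (resp. $\mu=\widetilde{\mu_\sigma}$, $\widetilde{\mu_\sigma}(c\otimes d)=\alpha\omega^{-1}(c_1)\sigma(c_2,\psi(d))-\sigma(\omega(c),d_1)\beta\psi^{-1}(d_2)-\lambda\varepsilon(c)\beta(d)$), written $cd$. A left $(C,\mu,\alpha_C,\beta_C)$-module $(M,\gamma,\alpha_M,\beta_M)$: a vector space $M$ with linear maps $\alpha_M,\beta_M:M\to M$, $\gamma:C\otimes M\to M$, $\gamma(c\otimes m)=c\triangleright m$, such that $\alpha_M\beta_M=\beta_M\alpha_M$, $\alpha_M(c\triangleright m)=\alpha_C(c)\triangleright\alpha_M(m)$, $\beta_M(c\triangleright m)=\beta_C(c)\triangleright\beta_M(m)$, $\alpha_C(c)\triangleright(d\triangleright m)=(cd)\triangleright\beta_M(m)$. A left $(C,\Delta,\psi_C,\omega_C)$-comodule $(M,\rho,\psi_M,\omega_M)$: a vector space $M$ with linear maps $\psi_M,\omega_M:M\to M$, $\rho:M\to C\otimes M$ such that $\psi_M\omega_M=\omega_M\psi_M$, $\rho\psi_M=(\psi_C\otimes\psi_M)\rho$, $\rho\omega_M=(\omega_C\otimes\omega_M)\rho$,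 $(\Delta\otimes\psi_M)\rho=(\omega_C\otimes\rho)\rho$. A (left) $\lambda$-infBH-Hopf module $(M,\gamma,\rho,\alpha_M,\beta_M,\psi_M,\omega_M)$ over a $\lambda$-infBH-bialgebra $(C,\mu,\Delta,\alpha_C,\beta_C,\psi_C,\omega_C)$: $(M,\gamma,\alpha_M,\beta_M)$ is a left module, $(M,\rho,\psi_M,\omega_M)$ is a left comodule, any two of $\alpha_M,\beta_M,\psi_M,\omega_M$ commute, and $$(c\triangleright m)_{-1}\otimes(c\triangleright m)_0=\omega_C(c)m_{-1}\otimes\beta_M(m_0)+\alpha_C(c_1)\otimes c_2\triangleright\psi_M(m)+\lambda\,\alpha_C\omega_C(c)\otimes\beta_M\psi_M(m).$$
   Formalization: False as stated; added: α_M commutes with β_M, ψ_M, ω_M; β_M commutes with ω_M; ρα_M=(α_C⊗α_M)ρ (also for ρ̃); in (1), if λ≠0, the comodule is counitary: ε(m_{-1})m_0=ψ_M(m). The implicit α_Cβ_C=β_Cα_C is made explicit. *)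

(* Defs.v *)
From HB Require Import structures.
From mathcomp Require Import all_boot all_order all_algebra.
From mathcomp Require Import boolp classical_sets.

Set Implicit Arguments.
Unset Strict Implicit.
Unset Printing Implicit Defensive.

Import GRing.Theory.
Local Open Scope ring_scope.
Local Open Scope quotient_scope.

Section Bilinear.
Variables (K : fieldType) (V W X : lmodType K).

Definition bilinear_map (f : V -> W -> X) : Prop :=
  (forall w, linear (f^~ w)) /\ (forall v, linear (f v)).

Lemma bilinear_map0l f w : bilinear_map f -> f 0 w = 0.
Proof.
by case=> + _ => /(_ w (-1) 0 0); rewrite scaler0 addr0 scaleN1r addNr.
Qed.

Lemma bilinear_mapZl f a v w : bilinear_map f -> f (a *: v) w = a *: f v w.
Proof.
by move=> bf; case: (bf) => + _ => /(_ w a v 0); rewrite addr0 bilinear_map0l // addr0.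
Qed.

End Bilinear.

Section Tensor.
Variables (K : fieldType) (V W : lmodType K).
Implicit Types s t : seq (V * W).

(* The list [:: (v1, w1); ...; (vn, wn)] stands for the formal sum
   v1 (x) w1 + ... + vn (x) wn.  Two formal sums are identified when no
   bilinear map separates them, which is the congruence generated by the
   bilinearity relations; see tensor_lift and tensor_linear_ext below for the
   universal property. *)
Definition tensor_equiv s t : bool :=
  `[< forall (X : lmodType K) (f : V -> W -> X), bilinear_map f ->
        \sum_(p <- s) f p.1 p.2 = \sum_(p <- t) f p.1 p.2 >].

Lemma tensor_equiv_is_equiv : equiv_class_of tensor_equiv.
Proof.
split=> [s|s t|t s u].
- exact/asboolP.
- by apply/asboolP/asboolP => eq_st X f bf; rewrite eq_st.
- by move=> /asboolP eq_st /asboolP eq_tu; apply/asboolP => X f bf;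
    rewrite eq_st ?eq_tu.
Qed.

Canonical tensor_equiv_equiv := EquivRelPack tensor_equiv_is_equiv.

Definition tensor : Type := {eq_quot tensor_equiv}.

HB.instance Definition _ := Choice.on tensor.
HB.instance Definition _ := EqQuotient.on tensor.

Definition pure (v : V) (w : W) : tensor := \pi_tensor [:: (v, w)].

(* Sweedler notation.  The value does not depend on the chosen representative
   as soon as E is bilinear, which is the case in all uses below. *)
Definition sweedler (X : zmodType) (t : tensor) (E : V -> W -> X) : X :=
  \sum_(p <- repr t) E p.1 p.2.

Lemma tensorP s t : reflect
  (forall (X : lmodType K) (f : V -> W -> X), bilinear_map f ->
     \sum_(p <- s) f p.1 p.2 = \sum_(p <- t) f p.1 p.2)
  (\pi_tensor s == \pi_tensor t).
Proof. by rewrite (eqquotE tensor); exact: asboolP. Qed.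

Lemma sweedler_pi (X : lmodType K) (f : V -> W -> X) s :
  bilinear_map f -> sweedler (\pi_tensor s) f = \sum_(p <- s) f p.1 p.2.
Proof.
by move=> bf; rewrite /sweedler; apply: (elimT (tensorP _ _)) bf; rewrite reprK.
Qed.

Definition tensor_zero : tensor := \pi_tensor [::].
Definition tensor_opp (x : tensor) : tensor :=
  \pi_tensor [seq (- p.1, p.2) | p <- repr x].
Definition tensor_add (x y : tensor) : tensor :=
  \pi_tensor (repr x ++ repr y).
Definition tensor_scale (a : K) (x : tensor) : tensor :=
  \pi_tensor [seq (a *: p.1, p.2) | p <- repr x].

Lemma tensor_eqP (x y : tensor) :
  (forall (X : lmodType K) (f : V -> W -> X), bilinear_map f ->
     sweedler x f = sweedler y f) -> x = y.
Proof.
move=> eq_xy; rewrite -[x]reprK -[y]reprK; apply/eqP/tensorP => X f bf.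
exact: eq_xy.
Qed.

Section Sweedler.
Variables (X : lmodType K) (f : V -> W -> X).
Hypothesis bf : bilinear_map f.

Lemma sweedler_zero : sweedler tensor_zero f = 0.
Proof. by rewrite sweedler_pi // big_nil. Qed.

Lemma sweedler_opp x : sweedler (tensor_opp x) f = - sweedler x f.
Proof.
rewrite sweedler_pi // big_map -sumrN; apply: eq_bigr => p _ /=.
by rewrite -scaleN1r bilinear_mapZl // scaleN1r.
Qed.

Lemma sweedler_add x y : sweedler (tensor_add x y) f = sweedler x f + sweedler y f.
Proof. by rewrite sweedler_pi // big_cat. Qed.

Lemma sweedler_scale a x : sweedler (tensor_scale a x) f = a *: sweedler x f.
Proof.
rewrite sweedler_pi // big_map scaler_sumr; apply: eq_bigr => p _ /=.
by rewrite bilinear_mapZl.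
Qed.

End Sweedler.

Lemma tensor_addA : associative tensor_add.
Proof. by move=> x y z; apply: tensor_eqP => X f bf; rewrite !sweedler_add // addrA. Qed.
Lemma tensor_addC : commutative tensor_add.
Proof. by move=> x y; apply: tensor_eqP => X f bf; rewrite !sweedler_add // addrC. Qed.
Lemma tensor_add0 : left_id tensor_zero tensor_add.
Proof.
by move=> x; apply: tensor_eqP => X f bf; rewrite sweedler_add // sweedler_zero // add0r.
Qed.
Lemma tensor_addN : left_inverse tensor_zero tensor_opp tensor_add.
Proof.
move=> x; apply: tensor_eqP => X f bf.
by rewrite sweedler_add // sweedler_opp // sweedler_zero // addNr.
Qed.

HB.instance Definition _ := GRing.isZmodule.Build tensor
  tensor_addA tensor_addC tensor_add0 tensor_addN.

Lemma tensor_scaleA a b x : tensor_scale a (tensor_scale b x) = tensor_scale (a * b) x.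
Proof. by apply: tensor_eqP => X f bf; rewrite !sweedler_scale // scalerA. Qed.
Lemma tensor_scale1 : left_id 1 tensor_scale.
Proof. by move=> x; apply: tensor_eqP => X f bf; rewrite sweedler_scale // scale1r. Qed.
Lemma tensor_scaleDr : right_distributive tensor_scale +%R.
Proof.
move=> a x y; apply: tensor_eqP => X f bf.
by rewrite sweedler_scale // !sweedler_add // !sweedler_scale // scalerDr.
Qed.
Lemma tensor_scaleDl x : {morph tensor_scale^~ x : a b / a + b}.
Proof.
move=> a b; apply: tensor_eqP => X f bf.
by rewrite sweedler_add // !sweedler_scale // scalerDl.
Qed.

HB.instance Definition _ := GRing.Zmodule_isLmodule.Build K tensor
  tensor_scaleA tensor_scale1 tensor_scaleDr tensor_scaleDl.

Lemma sweedler_pure (X : lmodType K) (f : V -> W -> X) v w :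
  bilinear_map f -> sweedler (pure v w) f = f v w.
Proof. by move=> bf; rewrite sweedler_pi // big_seq1. Qed.

Lemma sweedler_linear (X : lmodType K) (f : V -> W -> X) :
  bilinear_map f -> linear (fun t : tensor => sweedler t f).
Proof. by move=> bf a x y; rewrite sweedler_add // sweedler_scale. Qed.

Lemma pure_bilinear : bilinear_map pure.
Proof.
split=> [w a v v'|v a w w']; apply: tensor_eqP => X f bf.
  by rewrite sweedler_linear // !sweedler_pure //; case: (bf) => + _; apply.
by rewrite sweedler_linear // !sweedler_pure //; case: (bf) => _; apply.
Qed.

Lemma tensor_sum (t : tensor) : t = sweedler t pure.
Proof.
rewrite /sweedler -{1}[t]reprK; elim: (repr t) => [|[v w] s IHs].
  by rewrite big_nil.
rewrite big_cons -IHs; apply: tensor_eqP => X f bf.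
by rewrite sweedler_add // sweedler_pure // !sweedler_pi // big_cons.
Qed.

Lemma tensor_lift (X : lmodType K) (f : V -> W -> X) : bilinear_map f ->
  {g : {linear tensor -> X} | forall v w, g (pure v w) = f v w}.
Proof.
move=> bf.
pose L := GRing.isLinear.Build K tensor X *:%R (fun x => sweedler x f) (sweedler_linear bf).
pose g : {linear tensor -> X} := HB.pack (fun x : tensor => sweedler x f) L.
by exists g => v w; rewrite /= sweedler_pure.
Qed.

Lemma tensor_linear_ext (X : lmodType K) (g h : {linear tensor -> X}) :
  (forall v w, g (pure v w) = h (pure v w)) -> g =1 h.
Proof.
move=> eq_gh t; rewrite [t]tensor_sum /sweedler !linear_sum.
by apply: eq_bigr => p _; apply: eq_gh.
Qed.

End Tensor.

Notation "x ⊗ y" := (pure x y) (at level 39, left associativity) : ring_scope.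
Notation "\sw_ ( x ⊗ y <- t ) E" := (sweedler t (fun x y => E))
  (at level 41, x at level 38, y at level 38, t at level 99, E at level 41,
   format "\sw_ ( x  ⊗  y  <-  t )  E") : ring_scope.

Section Maps.
Variable K : fieldType.

Definition tensor_map (V V' W W' : lmodType K) (f : V -> V') (g : W -> W')
  (t : tensor V W) : tensor V' W' := \sw_(x ⊗ y <- t) (f x ⊗ g y).

Definition tensor_assoc (U V W : lmodType K) (t : tensor (tensor U V) W) :
    tensor U (tensor V W) :=
  \sw_(p ⊗ z <- t) \sw_(x ⊗ y <- p) (x ⊗ (y ⊗ z)).

(* Meaningful for bijective f only. *)
Definition inverse (V : lmodType K) (f : V -> V) (y : V) : V :=
  xget 0 [set x | f x = y]%classic.

Lemma inverseK (V : lmodType K) (f : V -> V) : bijective f -> cancel f (inverse f).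
Proof.
move=> bij_f x; apply: xget_unique => //= y /(bij_inj bij_f); exact.
Qed.

Lemma Kinverse (V : lmodType K) (f : V -> V) : bijective f -> cancel (inverse f) f.
Proof.
move=> [g fK gK] y; rewrite -[in inverse f y](gK y) inverseK ?gK //.
by exists g.
Qed.

End Maps.

Section Structures.
Variable K : fieldType.

(* Throughout, a linear map C (x) M -> M defined by a formula on pure tensors
   (a multiplication or an action) is given as a bilinear map C -> M -> M. *)

Record BiHom_algebra (A : lmodType K) (mu : A -> A -> A)
    (alpha beta : {linear A -> A}) : Prop := {
  bha_bilinear : bilinear_map mu;
  bha_comm : forall a, alpha (beta a) = beta (alpha a);
  bha_alphaM : forall a b, alpha (mu a b) = mu (alpha a) (alpha b);
  bha_betaM : forall a b, beta (mu a b) = mu (beta a) (beta b);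
  bha_assoc : forall a b c, mu (alpha a) (mu b c) = mu (mu a b) (beta c)
}.

Record BiHom_coalgebra (C : lmodType K) (Delta : {linear C -> tensor C C})
    (psi omega : {linear C -> C}) : Prop := {
  bhc_comm : forall c, psi (omega c) = omega (psi c);
  bhc_psi : forall c, tensor_map psi psi (Delta c) = Delta (psi c);
  bhc_omega : forall c, tensor_map omega omega (Delta c) = Delta (omega c);
  bhc_coassoc : forall c,
    tensor_assoc (tensor_map Delta psi (Delta c)) =
    tensor_map omega Delta (Delta c)
}.

Record counitary_BiHom_coalgebra (C : lmodType K) (Delta : {linear C -> tensor C C})
    (eps : {scalar C}) (psi omega : {linear C -> C}) : Prop := {
  cbhc_coalgebra : BiHom_coalgebra Delta psi omega;
  cbhc_eps_psi : forall c, eps (psi c) = eps c;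
  cbhc_eps_omega : forall c, eps (omega c) = eps c;
  cbhc_counitr : forall c, \sw_(c1 ⊗ c2 <- Delta c) (eps c2 *: c1) = omega c;
  cbhc_counitl : forall c, \sw_(c1 ⊗ c2 <- Delta c) (eps c1 *: c2) = psi c
}.

Record infBH_bialgebra (lam : K) (A : lmodType K) (mu : A -> A -> A)
    (Delta : {linear A -> tensor A A}) (alpha beta psi omega : {linear A -> A}) :
    Prop := {
  bhb_algebra : BiHom_algebra mu alpha beta;
  bhb_coalgebra : BiHom_coalgebra Delta psi omega;
  bhb_alpha_psi : forall a, alpha (psi a) = psi (alpha a);
  bhb_alpha_omega : forall a, alpha (omega a) = omega (alpha a);
  bhb_beta_psi : forall a, beta (psi a) = psi (beta a);
  bhb_beta_omega : forall a, beta (omega a) = omega (beta a);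
  bhb_alpha_Delta : forall a, tensor_map alpha alpha (Delta a) = Delta (alpha a);
  bhb_beta_Delta : forall a, tensor_map beta beta (Delta a) = Delta (beta a);
  bhb_psiM : forall a b, psi (mu a b) = mu (psi a) (psi b);
  bhb_omegaM : forall a b, omega (mu a b) = mu (omega a) (omega b);
  bhb_Delta_mu : forall a b,
    Delta (mu a b) =
      \sw_(b1 ⊗ b2 <- Delta b) (mu (omega a) b1 ⊗ beta b2)
      + \sw_(a1 ⊗ a2 <- Delta a) (alpha a1 ⊗ mu a2 (psi b))
      + lam *: (alpha (omega a) ⊗ beta (psi b))
}.

(* The common part of the coquasitriangular (kappa = lam) and the
   anti-coquasitriangular (kappa = - lam) axioms.  The relation
   alpha beta = beta alpha belongs to the axioms of the BiHom-associative
   algebra carried by C; it does not follow from the other clauses. *)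
Record coquasitriangular_axioms (kappa : K) (C : lmodType K)
    (Delta : {linear C -> tensor C C}) (eps : {scalar C})
    (alpha beta psi omega : {linear C -> C}) (sigma : {scalar (tensor C C)}) :
    Prop := {
  cqt_coalgebra : counitary_BiHom_coalgebra Delta eps psi omega;
  cqt_psi_bij : bijective psi;
  cqt_omega_bij : bijective omega;
  cqt_alpha_beta : forall c, alpha (beta c) = beta (alpha c);
  cqt_alpha_psi : forall c, alpha (psi c) = psi (alpha c);
  cqt_alpha_omega : forall c, alpha (omega c) = omega (alpha c);
  cqt_beta_psi : forall c, beta (psi c) = psi (beta c);
  cqt_beta_omega : forall c, beta (omega c) = omega (beta c);
  cqt_alpha_Delta : forall c, tensor_map alpha alpha (Delta c) = Delta (alpha c);
  cqt_beta_Delta : forall c, tensor_map beta beta (Delta c) = Delta (beta c);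
  cqt_eps_alpha : forall c, eps (alpha c) = eps c;
  cqt_eps_beta : forall c, eps (beta c) = eps c;
  cqt_sigma_alpha : forall t, sigma (tensor_map alpha alpha t) = sigma t;
  cqt_sigma_beta : forall t, sigma (tensor_map beta beta t) = sigma t;
  cqt_sigma_psi : forall t, sigma (tensor_map psi psi t) = sigma t;
  cqt_sigma_omega : forall t, sigma (tensor_map omega omega t) = sigma t;
  cqt_sigma : forall c d e,
    \sw_(c1 ⊗ c2 <- Delta c)
        (sigma (alpha c1 ⊗ beta (omega e)) * sigma (c2 ⊗ psi d))
    - \sw_(d1 ⊗ d2 <- Delta d) (sigma (omega c ⊗ d1) * sigma (d2 ⊗ psi e))
    + \sw_(e1 ⊗ e2 <- Delta e)
        (sigma (omega d ⊗ e1) * sigma (alpha (psi c) ⊗ beta e2))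
    = kappa * sigma (alpha c ⊗ beta e) * eps d
}.

Definition coquasitriangular (lam : K) := coquasitriangular_axioms lam.
Definition anti_coquasitriangular (lam : K) := coquasitriangular_axioms (- lam).

Definition mu_sigma (lam : K) (C : lmodType K) (Delta : {linear C -> tensor C C})
    (eps : {scalar C}) (alpha beta psi omega : {linear C -> C})
    (sigma : {scalar (tensor C C)}) (c d : C) : C :=
  \sw_(c1 ⊗ c2 <- Delta c) (sigma (c2 ⊗ psi d) *: alpha (inverse omega c1))
  - \sw_(d1 ⊗ d2 <- Delta d) (sigma (omega c ⊗ d1) *: beta (inverse psi d2))
  - (lam * eps d) *: alpha c.

Definition mu_sigma_tilde (lam : K) (C : lmodType K)
    (Delta : {linear C -> tensor C C}) (eps : {scalar C})
    (alpha beta psi omega : {linear C -> C})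
    (sigma : {scalar (tensor C C)}) (c d : C) : C :=
  \sw_(c1 ⊗ c2 <- Delta c) (sigma (c2 ⊗ psi d) *: alpha (inverse omega c1))
  - \sw_(d1 ⊗ d2 <- Delta d) (sigma (omega c ⊗ d1) *: beta (inverse psi d2))
  - (lam * eps c) *: beta d.

Record left_module (C : lmodType K) (mu : C -> C -> C)
    (alphaC betaC : {linear C -> C}) (M : lmodType K) (act : C -> M -> M)
    (alphaM betaM : {linear M -> M}) : Prop := {
  lm_bilinear : bilinear_map act;
  lm_comm : forall m, alphaM (betaM m) = betaM (alphaM m);
  lm_alpha : forall c m, alphaM (act c m) = act (alphaC c) (alphaM m);
  lm_beta : forall c m, betaM (act c m) = act (betaC c) (betaM m);
  lm_assoc : forall c d m, act (alphaC c) (act d m) = act (mu c d) (betaM m)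
}.

Record left_comodule (C : lmodType K) (Delta : {linear C -> tensor C C})
    (psiC omegaC : {linear C -> C}) (M : lmodType K)
    (rho : {linear M -> tensor C M}) (psiM omegaM : {linear M -> M}) : Prop := {
  lc_comm : forall m, psiM (omegaM m) = omegaM (psiM m);
  lc_psi : forall m, rho (psiM m) = tensor_map psiC psiM (rho m);
  lc_omega : forall m, rho (omegaM m) = tensor_map omegaC omegaM (rho m);
  lc_coassoc : forall m,
    tensor_assoc (tensor_map Delta psiM (rho m)) =
    tensor_map omegaC rho (rho m)
}.

Record infBH_Hopf_module (lam : K) (C : lmodType K) (mu : C -> C -> C)
    (Delta : {linear C -> tensor C C}) (alphaC betaC psiC omegaC : {linear C -> C})
    (M : lmodType K) (act : C -> M -> M) (rho : {linear M -> tensor C M})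
    (alphaM betaM psiM omegaM : {linear M -> M}) : Prop := {
  hm_bialgebra : infBH_bialgebra lam mu Delta alphaC betaC psiC omegaC;
  hm_module : left_module mu alphaC betaC act alphaM betaM;
  hm_comodule : left_comodule Delta psiC omegaC rho psiM omegaM;
  hm_alpha_beta : forall m, alphaM (betaM m) = betaM (alphaM m);
  hm_alpha_psi : forall m, alphaM (psiM m) = psiM (alphaM m);
  hm_alpha_omega : forall m, alphaM (omegaM m) = omegaM (alphaM m);
  hm_beta_psi : forall m, betaM (psiM m) = psiM (betaM m);
  hm_beta_omega : forall m, betaM (omegaM m) = omegaM (betaM m);
  hm_psi_omega : forall m, psiM (omegaM m) = omegaM (psiM m);
  hm_rho_act : forall c m,
    rho (act c m) =
      \sw_(m1 ⊗ m0 <- rho m) (mu (omegaC c) m1 ⊗ betaM m0)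
      + \sw_(c1 ⊗ c2 <- Delta c) (alphaC c1 ⊗ act c2 (psiM m))
      + lam *: (alphaC (omegaC c) ⊗ betaM (psiM m))
}.

End Structures.

(* Main.v *)
(* Passing to (omega_C^-1 (x) psi_C^-1) Delta and (omega_C^-1 (x) psi_M^-1) rho
   turns C and M into an ordinary coalgebra and an ordinary comodule, and psi and
   omega disappear from all formulas.  Put
     L(c, d) = c_1 sigma(c_2, d) - l1 eps(d) c,
     R(c, m) = sigma(c, m_-1) m_0 + l2 eps(c) m,
   where (l1, l2) is (lambda, 0) in part (1) and (0, lambda) in part (2).  Then
   both products are alpha L(c, d) - beta R(c, d), both actions are
   - beta_M R(c, m), and in both cases kappa = l1 - l2, lambda = l1 + l2 and
   l1 l2 = 0.  The sigma-axiom becomes the pair of Yang-Baxter-type identities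
     L(alpha L(c, d), beta e) - alpha L(c, L(d, e)) + L(alpha c, beta R(d, e)) = 0,
     R(alpha L(c, d), beta m) - beta R(R(c, d), m) + R(alpha c, beta R(d, m)) = 0,
   from which the associativity of the product and of the action follows by
   bilinearity; the counit of M enters only through the l1 term. *)
From HB Require Import structures.
Require Import Defs.
From mathcomp Require Import all_boot all_order all_algebra.
From mathcomp Require Import boolp ring.

Set Implicit Arguments.
Unset Strict Implicit.
Unset Printing Implicit Defensive.
Import GRing.Theory.
Local Open Scope ring_scope.

(** * Bilinear maps, inverses of linear bijections, and linearity as a predicate *)

Section BilinearTheory.
Variables (K : fieldType) (V W X : lmodType K) (f : V -> W -> X).
Hypothesis bf : bilinear_map f.

Lemma bilinear_mapDl v v' w : f (v + v') w = f v w + f v' w.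
Proof. by case: bf => /(_ w 1 v v') + _; rewrite !scale1r. Qed.

Lemma bilinear_mapDr v w w' : f v (w + w') = f v w + f v w'.
Proof. by case: bf => _ /(_ v 1 w w'); rewrite !scale1r. Qed.

Lemma bilinear_map0r v : f v 0 = 0.
Proof. by apply: (addrI (f v 0)); rewrite -bilinear_mapDr !addr0. Qed.

Lemma bilinear_mapZr a v w : f v (a *: w) = a *: f v w.
Proof. by case: bf => _ /(_ v a w 0); rewrite !addr0 bilinear_map0r addr0. Qed.

Lemma bilinear_mapBl v v' w : f (v - v') w = f v w - f v' w.
Proof. by rewrite bilinear_mapDl -scaleN1r bilinear_mapZl // scaleN1r. Qed.

Lemma bilinear_mapBr v w w' : f v (w - w') = f v w - f v w'.
Proof. by rewrite bilinear_mapDr -scaleN1r bilinear_mapZr scaleN1r. Qed.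

End BilinearTheory.

Section BilinearConstructions.
Variables (K : fieldType) (V V' W W' X Y : lmodType K).

Lemma bilinear_map_comp (f : V -> W -> X) (g : V' -> V) (h : W' -> W) :
  bilinear_map f -> linear g -> linear h ->
  bilinear_map (fun v w => f (g v) (h w)).
Proof.
move=> [fl fr] lg lh; split=> [w|v] a x y.
  by rewrite lg; apply: fl.
by rewrite lh; apply: fr.
Qed.

Lemma linear_bilinear_map (f : V -> W -> X) (g : X -> Y) :
  bilinear_map f -> linear g -> bilinear_map (fun v w => g (f v w)).
Proof.
by move=> [fl fr] lg; split=> [w|v] a x y; rewrite (fl, fr) lg.
Qed.

Lemma bilinear_map_scalel (f : V -> K^o) (g : W -> X) :
  linear f -> linear g -> bilinear_map (fun v w => f v *: g w).
Proof.
move=> lf lg; split=> [w|v] a x y; first by rewrite lf scalerDl scalerA.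
by rewrite lg scalerDr !scalerA mulrC.
Qed.

Lemma bilinear_map_scaler (f : W -> K^o) (g : V -> X) :
  linear f -> linear g -> bilinear_map (fun v w => f w *: g v).
Proof.
move=> lf lg; split=> [w|v] a x y; last by rewrite lf scalerDl scalerA.
by rewrite lg scalerDr !scalerA mulrC.
Qed.

Lemma bilinear_mapB (f g : V -> W -> X) :
  bilinear_map f -> bilinear_map g -> bilinear_map (fun v w => f v w - g v w).
Proof.
by move=> [fl fr] [gl gr]; split=> [w|v] a x y;
  rewrite (fl, fr) (gl, gr) scalerBr opprD addrACA.
Qed.

Lemma bilinear_mapD (f g : V -> W -> X) :
  bilinear_map f -> bilinear_map g -> bilinear_map (fun v w => f v w + g v w).
Proof.
by move=> [fl fr] [gl gr]; split=> [w|v] a x y;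
  rewrite (fl, fr) (gl, gr) scalerDr addrACA.
Qed.

End BilinearConstructions.

Lemma linear_inverse (K : fieldType) (V : lmodType K) (f : {linear V -> V}) :
  bijective f -> linear (inverse f).
Proof.
move=> bij_f a x y; apply: (bij_inj bij_f).
by rewrite linearP !Kinverse.
Qed.

Lemma inverse_commute (K : fieldType) (V : lmodType K) (f g : V -> V) :
  bijective f -> (forall x, g (f x) = f (g x)) ->
  forall x, g (inverse f x) = inverse f (g x).
Proof.
by move=> bij_f fg x; apply: (bij_inj bij_f); rewrite -fg !Kinverse.
Qed.

Section LinearPredicate.
Variables (K : fieldType) (V W : lmodType K) (f : V -> W).
Hypothesis lf : linear f.

(** Slices and untwisted sums are plain functions with a separate proof of linearity; bundling [f]
    locally makes the library lemmas on linear maps available for them. *)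
Lemma linear_map_sum I (r : seq I) (F : I -> V) :
  f (\sum_(i <- r) F i) = \sum_(i <- r) f (F i).
Proof.
pose L := GRing.isLinear.Build K V W *:%R f lf.
pose g : {linear V -> W} := HB.pack f L.
exact: (linear_sum g).
Qed.

Lemma linear_mapZ a v : f (a *: v) = a *: f v.
Proof.
pose L := GRing.isLinear.Build K V W *:%R f lf.
pose g : {linear V -> W} := HB.pack f L.
exact: (linearZ_LR g).
Qed.

Lemma linear_mapD u v : f (u + v) = f u + f v.
Proof. by have := lf 1 u v; rewrite !scale1r. Qed.

Lemma linear_mapB u v : f (u - v) = f u - f v.
Proof. by rewrite linear_mapD -scaleN1r linear_mapZ scaleN1r. Qed.

End LinearPredicate.

Lemma tensor_map_pure (K : fieldType) (V V' W W' : lmodType K)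
    (g : {linear V -> V'}) (h : {linear W -> W'}) v w :
  tensor_map g h (v ⊗ w) = g v ⊗ h w.
Proof.
rewrite /tensor_map sweedler_pure //.
by apply: (bilinear_map_comp (pure_bilinear _ _)); apply: linearP.
Qed.

(** * Sweedler sums over transformed tensors *)

Section SweedlerTheory.
Variables (K : fieldType) (U V V' W W' X : lmodType K).

Lemma eq_sweedler (t : tensor V W) (f g : V -> W -> X) :
  f =2 g -> sweedler t f = sweedler t g.
Proof. by move=> eq_fg; apply: eq_bigr => p _; apply: eq_fg. Qed.

Lemma sweedler_tensor_map (g : V -> V') (h : W -> W') (f : V' -> W' -> X) t :
  bilinear_map f ->
  sweedler (tensor_map g h t) f = \sw_(x ⊗ y <- t) f (g x) (h y).
Proof.
move=> bf; rewrite /tensor_map {2}/sweedler.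
rewrite (linear_map_sum (sweedler_linear bf)).
by apply: eq_bigr => p _; rewrite sweedler_pure.
Qed.

Lemma sweedler_tensor_assoc (f : U -> tensor V W -> X)
    (t : tensor (tensor U V) W) :
  bilinear_map f ->
  sweedler (tensor_assoc t) f =
  \sw_(p ⊗ z <- t) \sw_(x ⊗ y <- p) f x (y ⊗ z).
Proof.
move=> bf; rewrite /tensor_assoc {2}/sweedler.
rewrite (linear_map_sum (sweedler_linear bf)).
apply: eq_bigr => p _; rewrite {2}/sweedler.
rewrite (linear_map_sum (sweedler_linear bf)).
by apply: eq_bigr => q _; rewrite sweedler_pure.
Qed.

End SweedlerTheory.

(* With (w, p) = (omega_C, psi_M) this is Sweedler summation over
   (omega_C^-1 (x) psi_M^-1) rho, which makes M an ordinary comodule over the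
   ordinary coalgebra (C, (omega_C^-1 (x) psi_C^-1) Delta). *)
Definition untwist (K : fieldType) (C M X : lmodType K) (w : C -> C)
    (p : M -> M) (rho : M -> tensor C M) (f : C -> M -> X) (m : M) : X :=
  \sw_(x ⊗ n <- rho m) f (inverse w x) (inverse p n).

(** * Calculus of untwisted Sweedler sums *)

Section Untwist.
Variables (K : fieldType) (C M : lmodType K) (w : {linear C -> C})
  (p : {linear M -> M}) (rho : {linear M -> tensor C M}).
Hypotheses (bij_w : bijective w) (bij_p : bijective p).
Local Notation un := (untwist w p rho).

Lemma eq_untwist (X : lmodType K) (f g : C -> M -> X) :
  f =2 g -> un f =1 un g.
Proof. by move=> eq_fg m; apply: eq_sweedler => x n; apply: eq_fg. Qed.

Lemma untwistD (X : lmodType K) (f g : C -> M -> X) m :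
  un (fun x n => f x n + g x n) m = un f m + un g m.
Proof. exact: big_split. Qed.

Lemma untwistB (X : lmodType K) (f g : C -> M -> X) m :
  un (fun x n => f x n - g x n) m = un f m - un g m.
Proof. exact: sumrB. Qed.

Lemma untwistZ (X : lmodType K) a (f : C -> M -> X) m :
  un (fun x n => a *: f x n) m = a *: un f m.
Proof. by rewrite /untwist /sweedler scaler_sumr. Qed.

Lemma linear_untwistE (X Y : lmodType K) (g : X -> Y) (f : C -> M -> X) m :
  linear g -> g (un f m) = un (fun x n => g (f x n)) m.
Proof. by move=> lg; apply: linear_map_sum. Qed.

Lemma untwist_exchange (D N X : lmodType K) (w' : D -> D) (p' : N -> N)
    (rho' : N -> tensor D N) (F : C -> M -> D -> N -> X) m n :
  un (fun x k => untwist w' p' rho' (F x k) n) m =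
  untwist w' p' rho' (fun y l => un (fun x k => F x k y l) m) n.
Proof. exact: exchange_big. Qed.

Lemma untwist_linear (X : lmodType K) (f : C -> M -> X) :
  bilinear_map f -> linear (un f).
Proof.
move=> bf a m n; rewrite /untwist linearP; apply: sweedler_linear.
by apply: bilinear_map_comp => //; apply: linear_inverse.
Qed.

Lemma untwist_linear_family (V X : lmodType K) (F : V -> C -> M -> X) m :
  (forall x n, linear (fun v => F v x n)) -> linear (fun v => un (F v) m).
Proof.
move=> lF a u v; rewrite /untwist /sweedler scaler_sumr -big_split /=.
by apply: eq_bigr => q _; rewrite lF.
Qed.

Lemma untwist_pure m : un (fun x n => w x ⊗ p n) m = rho m.
Proof.
rewrite [RHS]tensor_sum; apply: eq_sweedler => x n.
by rewrite !Kinverse.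
Qed.

(** Naturality: a pair (g, h) compatible with the coaction and commuting with the twists is also
    compatible with the untwisted coaction, because it commutes with the inverse twists. *)
Lemma untwist_morph (X : lmodType K) (g : C -> C) (h : M -> M)
    (f : C -> M -> X) m :
  bilinear_map f -> (forall x, g (w x) = w (g x)) ->
  (forall n, h (p n) = p (h n)) -> rho (h m) = tensor_map g h (rho m) ->
  un f (h m) = un (fun x n => f (g x) (h n)) m.
Proof.
move=> bf gw hp rho_h; rewrite /untwist rho_h sweedler_tensor_map; last first.
  by apply: bilinear_map_comp => //; apply: linear_inverse.
by apply: eq_sweedler => x n; rewrite !inverse_commute.
Qed.

Lemma untwist_inverse (X : lmodType K) (g : {linear C -> C})
    (h : {linear M -> M}) (f : C -> M -> X) m :
  bilinear_map f -> bijective g -> bijective h ->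
  (forall x, g (w x) = w (g x)) -> (forall n, h (p n) = p (h n)) ->
  (forall m, rho (h m) = tensor_map g h (rho m)) ->
  un f (inverse h m) = un (fun x n => f (inverse g x) (inverse h n)) m.
Proof.
move=> bf bij_g bij_h gw hp rho_h; rewrite -{2}[m](Kinverse bij_h).
rewrite (untwist_morph _ gw hp) //; last first.
  by apply: bilinear_map_comp => //; apply: linear_inverse.
by apply: eq_untwist => x n; rewrite !inverseK.
Qed.

End Untwist.

Arguments linear_untwistE {K C M w p rho X Y g f m}.

(** * Ordinary coassociativity of the untwisted coaction *)

Section Coassociativity.
Variables (K : fieldType) (C : lmodType K) (Delta : {linear C -> tensor C C})
  (psi omega : {linear C -> C}) (M : lmodType K)
  (rho : {linear M -> tensor C M}) (psiM omegaM : {linear M -> M}).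
Hypotheses (coalgC : BiHom_coalgebra Delta psi omega)
  (comodM : left_comodule Delta psi omega rho psiM omegaM)
  (bij_psi : bijective psi) (bij_omega : bijective omega)
  (bij_psiM : bijective psiM).

(** BiHom-coassociativity is tested against a trilinear map obtained from [F] by inserting inverse
    twists; naturality under [omega] on one side and under [psi] on the other moves these inverses
    to the right places. *)
Lemma untwist_coassoc (X : lmodType K) (F : C -> C -> M -> X) m :
  (forall n, bilinear_map (fun x y => F x y n)) ->
  (forall x, bilinear_map (F x)) ->
  untwist omega psiM rho
    (fun x n => untwist omega psi Delta (fun y z => F y z n) x) m =
  untwist omega psiM rho (fun x n => untwist omega psiM rho (F x) n) m.
Proof.
move=> bF1 bF2.
have liw := linear_inverse bij_omega.
have lip := linear_inverse bij_psi.
have lipM := linear_inverse bij_psiM.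
pose iw := inverse omega; pose ip := inverse psi; pose iM := inverse psiM.
(* Two nested untwistings produce two inverse twists per leg. Where only one is produced, on the
   last leg of the left side and the first leg of the right side, the [psiM] or [omega] in the
   coassociativity axiom cancels the surplus one. *)
pose F' x y n := F (iw (iw x)) (ip (iw y)) (iM (iM n)).
have bF' x : bilinear_map (F' x).
  apply: (bilinear_map_comp (g := fun y => ip (iw y))
    (h := fun n => iM (iM n)) (bF2 _)).
    by move=> a u v; rewrite /iw /ip liw lip.
  by move=> a u v; rewrite /iM !lipM.
pose G x t := sweedler t (F' x).
have bG : bilinear_map G.
  split=> [t|x]; last exact: sweedler_linear.
  move=> a x x'; rewrite /G /sweedler scaler_sumr -big_split /=.
  apply: eq_bigr => q _; rewrite /F' /iw 2!liw.
  by have [+ _] := bF1 (iM (iM q.2)); apply.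
have := congr1 (fun t => sweedler t G) (lc_coassoc comodM m).
rewrite sweedler_tensor_assoc // !sweedler_tensor_map //; last first.
  split=> [n|t]; last first.
    move=> a n n'; rewrite /sweedler scaler_sumr -big_split /=.
    apply: eq_bigr => q _; rewrite -(proj2 bG); congr (G _ _).
    by case: (pure_bilinear C M) => _; apply.
  apply: sweedler_linear; apply: (bilinear_map_comp bG) => //.
  by case: (pure_bilinear C M) => + _; apply.
have eqF x n : untwist omega psi Delta (fun y z => F y z (iM n)) (iw x) =
    \sw_(y ⊗ z <- Delta x) G y (z ⊗ psiM n).
  rewrite (untwist_inverse bij_omega bij_psi (g := omega)) //.
  - apply: eq_sweedler => y z; rewrite /G sweedler_pure // /F' /iM inverseK //.
    congr F; apply: inverse_commute => // u; symmetry.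
    by apply: inverse_commute => // v; rewrite (bhc_comm coalgC).
  - by move=> y; rewrite (bhc_comm coalgC).
  - by move=> y; rewrite (bhc_omega coalgC).
have eqG x n : untwist omega psiM rho (F (iw x)) (iM n) = G (omega x) (rho n).
  rewrite (untwist_inverse bij_omega bij_psiM (g := psi)) //.
  - by apply: eq_sweedler => y k; rewrite /F' /iw /ip inverseK.
  - exact: bhc_comm coalgC.
  - exact: lc_psi comodM.
move=> eq_sw.
transitivity (\sw_(x ⊗ n <- rho m) \sw_(y ⊗ z <- Delta x) G y (z ⊗ psiM n)).
  by apply: eq_sweedler => x n; rewrite eqF.
by rewrite eq_sw; apply: eq_sweedler => x n; rewrite eqG.
Qed.

End Coassociativity.

(** * The form [sigma], the counit after untwisting, and left slices *)

Section Coquasitriangular.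
Variables (K : fieldType) (l1 l2 : K) (C : lmodType K)
  (Delta : {linear C -> tensor C C}) (eps : {scalar C})
  (alpha beta psi omega : {linear C -> C}) (sigma : {scalar (tensor C C)}).
Hypotheses (l12 : l1 * l2 = 0)
  (cqtC : coquasitriangular_axioms (l1 - l2) Delta eps alpha beta psi omega sigma).

Let coalgC := cbhc_coalgebra (cqt_coalgebra cqtC).
Let bij_psi := cqt_psi_bij cqtC.
Let bij_omega := cqt_omega_bij cqtC.

Lemma regular_comodule : left_comodule Delta psi omega Delta psi omega.
Proof. by case: coalgC => *; split. Qed.
Let comodC := regular_comodule.

Local Notation cun := (untwist omega psi Delta).

(** The target [K^o] is the field as a vector space over itself, so that [s] falls under the theory
    of bilinear maps. *)
Let s (c d : C) : K^o := sigma (c ⊗ d).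

Lemma sigma_pure_bilinear : bilinear_map s.
Proof.
by apply: (@linear_bilinear_map _ _ _ _ K^o _ sigma (pure_bilinear C C)) => a x y;
  rewrite linearP.
Qed.
Let bs := sigma_pure_bilinear.
Let sl d : linear (s^~ d). Proof. exact: (proj1 bs). Qed.
Let sr c : linear (s c). Proof. exact: (proj2 bs). Qed.

(** Used to move twists from one argument of [sigma] to the other as inverses. *)
Lemma sigma_pure_invariant (g : {linear C -> C}) c d :
  (forall t, sigma (tensor_map g g t) = sigma t) -> s (g c) (g d) = s c d.
Proof. by move=> /(_ (c ⊗ d)); rewrite tensor_map_pure. Qed.

Lemma untwist_counitl c : cun (fun x y => (eps x : K^o) *: y) c = c.
Proof.
have liw := linear_inverse bij_omega; have lip := linear_inverse bij_psi.
apply: (bij_inj bij_psi); rewrite -[RHS](cbhc_counitl (cqt_coalgebra cqtC)).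
rewrite linear_untwistE; last exact: linearP.
apply: eq_sweedler => x y; rewrite linearZ_LR /= Kinverse //.
by rewrite -{2}[x](Kinverse bij_omega) (cbhc_eps_omega (cqt_coalgebra cqtC)).
Qed.

Lemma untwist_counitr c : cun (fun x y => (eps y : K^o) *: x) c = c.
Proof.
have liw := linear_inverse bij_omega; have lip := linear_inverse bij_psi.
apply: (bij_inj bij_omega); rewrite -[RHS](cbhc_counitr (cqt_coalgebra cqtC)).
rewrite linear_untwistE; last exact: linearP.
apply: eq_sweedler => x y; rewrite linearZ_LR /= Kinverse //.
by rewrite -{2}[y](Kinverse bij_psi) (cbhc_eps_psi (cqt_coalgebra cqtC)).
Qed.

Definition left_slice (c d : C) : C :=
  cun (fun x y => s y d *: x) c - (l1 * eps d) *: c.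

Lemma left_slice_bilinear : bilinear_map left_slice.
Proof.
apply: bilinear_mapB; split=> [d|c].
- by apply: untwist_linear => //; apply: bilinear_map_scaler => //.
- by apply: untwist_linear_family => x y a u v; rewrite sr scalerDl scalerA.
- by move=> a u v; rewrite scalerDr !scalerA mulrC.
- by move=> a u v; rewrite linearP mulrDr scalerDl scalerA mulrCA.
Qed.
Let bL := left_slice_bilinear.

(** Isolates what [alpha], [beta], [psi] and [omega] have in common, so that one equivariance lemma
    per construction serves all four. *)
Definition coquasitriangular_endo (g : {linear C -> C}) : Prop :=
  [/\ forall c, g (psi c) = psi (g c), forall c, g (omega c) = omega (g c),
      forall c, Delta (g c) = tensor_map g g (Delta c),
      forall c, eps (g c) = eps c &
      forall t, sigma (tensor_map g g t) = sigma t].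

Lemma untwist_endo (g : {linear C -> C}) (X : lmodType K) (f : C -> C -> X) c :
  coquasitriangular_endo g -> bilinear_map f ->
  cun f (g c) = cun (fun x y => f (g x) (g y)) c.
Proof. by case=> gpsi gomega gDelta _ _ bf; apply: untwist_morph. Qed.

Lemma left_slice_endo (g : {linear C -> C}) c d :
  coquasitriangular_endo g -> g (left_slice c d) = left_slice (g c) (g d).
Proof.
move=> endo_g; have [_ _ _ geps gsigma] := endo_g.
rewrite /left_slice linearB linearZ_LR /= geps untwist_endo //; last first.
  exact: bilinear_map_scaler.
congr (_ - _); rewrite (linear_untwistE (linearP g)).
by apply: eq_untwist => x y; rewrite linearZ_LR sigma_pure_invariant.
Qed.

(** L(-, d) contracts the last leg of the coproduct with a linear form, up to a scalar multiple of
    the identity, so by coassociativity it passes to the second leg: the untwisted coproduct of L(c,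
    d) is c_1 ⊗ L(c_2, d). *)
Lemma untwist_left_slice (X : lmodType K) (f : C -> C -> X) c d :
  bilinear_map f ->
  cun f (left_slice c d) = cun (fun x y => f x (left_slice y d)) c.
Proof.
move=> bf; have lf := untwist_linear Delta bij_omega bij_psi bf.
have frl x : linear (f x) := proj2 bf x.
rewrite /left_slice linear_mapB // linear_mapZ // linear_untwistE //.
under [RHS]eq_untwist => x y do
  rewrite bilinear_mapBr // bilinear_mapZr // linear_untwistE //.
rewrite untwistB untwistZ; congr (_ - _).
have bZ n : bilinear_map (fun u v => s n d *: f u v).
  by apply: linear_bilinear_map => // k u v; rewrite linearP.
have bF x : bilinear_map (fun u v => s v d *: f x u).
  exact: bilinear_map_scaler.
have eq_F := untwist_coassoc coalgC comodC bij_psi bij_omega bij_psi c bZ bF.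
transitivity (cun (fun x n => cun (fun u v => s n d *: f u v) x) c).
  by apply: eq_untwist => x y; rewrite linear_mapZ // untwistZ.
rewrite eq_F; apply: eq_untwist => x y; apply: eq_untwist => u v.
by rewrite linear_mapZ.
Qed.

(** * Right slices, acting on a comodule *)

Section Coaction.
Variables (M : lmodType K) (rho : {linear M -> tensor C M})
  (psiM omegaM : {linear M -> M}).
Hypotheses (comodM : left_comodule Delta psi omega rho psiM omegaM)
  (bij_psiM : bijective psiM).

Local Notation un := (untwist omega psiM rho).

Definition right_slice (c : C) (m : M) : M :=
  un (fun x n => s c x *: n) m + (l2 * eps c) *: m.

Lemma right_slice_bilinear : bilinear_map right_slice.
Proof.
apply: bilinear_mapD; split=> [m|c].
- by apply: untwist_linear_family => x y a u v; rewrite sl scalerDl scalerA.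
- by apply: untwist_linear => //; apply: bilinear_map_scalel.
- by move=> a u v; rewrite linearP mulrDr scalerDl scalerA mulrCA.
- by move=> a u v; rewrite scalerDr !scalerA mulrC.
Qed.
Let bR := right_slice_bilinear.

Lemma right_slice_endo (g : {linear C -> C}) (h : {linear M -> M}) c m :
  coquasitriangular_endo g -> (forall m, h (psiM m) = psiM (h m)) ->
  (forall m, rho (h m) = tensor_map g h (rho m)) ->
  h (right_slice c m) = right_slice (g c) (h m).
Proof.
move=> [_ gomega _ geps gsigma] hpsi hrho.
rewrite /right_slice linearD linearZ_LR /= geps; congr (_ + _).
rewrite (untwist_morph bij_omega bij_psiM (g := g)) //; last first.
  exact: bilinear_map_scalel.
rewrite (linear_untwistE (linearP h)).
by apply: eq_untwist => x y; rewrite linearZ_LR sigma_pure_invariant.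
Qed.

(** Both sides contain the double sum of sigma(c_2, m_-1) f(c_1, m_0). The counit of M turns the
    correction in L into -l1 f(c, m), the counit of C turns the one in R into l2 f(c, m), and the
    difference is the term in l1 + l2. *)
Lemma untwist_left_slice_coaction (X : lmodType K) (f : C -> M -> X) c m :
  (l1 != 0 -> forall m, \sw_(m1 ⊗ m0 <- rho m) (eps m1 *: m0) = psiM m) ->
  bilinear_map f ->
  un (fun x n => f (left_slice c x) n) m =
  cun (fun x y => f x (right_slice y m)) c - (l1 + l2) *: f c m.
Proof.
move=> counitM bf.
have [fll frl] : (forall n, linear (f^~ n)) /\ (forall x, linear (f x)) by [].
have counit : l1 *: un (fun x n => (eps x : K^o) *: n) m = l1 *: m.
  (* The counit identity of M is available only for nonzero [l1]; otherwise both sides vanish. *)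
  have [->|nz_l1] := eqVneq l1 0; first by rewrite !scale0r.
  congr (_ *: _); apply: (bij_inj bij_psiM); rewrite -[RHS]counitM //.
  rewrite linear_untwistE; last exact: linearP.
  apply: eq_sweedler => x y; rewrite linearZ_LR /= Kinverse //.
  by rewrite -{2}[x](Kinverse bij_omega) (cbhc_eps_omega (cqt_coalgebra cqtC)).
under eq_untwist => x n do
  rewrite /left_slice bilinear_mapBl // bilinear_mapZl //
    (linear_untwistE (fll n)) /=
    -scalerA -(bilinear_mapZr bf).
under [in RHS]eq_untwist => x y do
  rewrite /right_slice bilinear_mapDr // bilinear_mapZr // linear_untwistE //
    -scalerA -(bilinear_mapZl _ _ _ bf).
rewrite untwistB untwistZ untwistD untwistZ.
rewrite -(linear_untwistE (frl c)) -(linear_untwistE (fll m)).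
rewrite untwist_counitr -(bilinear_mapZr bf) counit (bilinear_mapZr bf).

rewrite untwist_exchange scalerDl [l1 *: _ + _]addrC opprD addrA addrK.
congr (_ - _); apply: eq_untwist => x y; apply: eq_untwist => z n.
by rewrite (bilinear_mapZl _ _ _ bf) (bilinear_mapZr bf).
Qed.

End Coaction.

Local Notation L := left_slice.
Local Notation R := (right_slice Delta psi).

Let bR : bilinear_map R := right_slice_bilinear Delta bij_psi.

Section RightSlice.
Variables (M : lmodType K) (rho : {linear M -> tensor C M})
  (psiM omegaM : {linear M -> M}).
Hypotheses (comodM : left_comodule Delta psi omega rho psiM omegaM)
  (bij_psiM : bijective psiM).

(** Mirror image of [untwist_left_slice]: R(d, -) contracts the first leg, so coassociativity lets
    it act on the C-leg of the coaction. *)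
Lemma untwist_right_slice (X : lmodType K) (f : C -> M -> X) d m :
  bilinear_map f ->
  untwist omega psiM rho f (right_slice rho psiM d m) =
  untwist omega psiM rho (fun x n => f (R d x) n) m.
Proof.
move=> bf; have lf := untwist_linear rho bij_omega bij_psiM bf.
have [fll frl] : (forall n, linear (f^~ n)) /\ (forall x, linear (f x)) by [].
rewrite /right_slice linear_mapD // linear_mapZ // (linear_untwistE lf).
under [RHS]eq_untwist => x y do
  rewrite bilinear_mapDl // bilinear_mapZl // (linear_untwistE (fll y)) /=.
rewrite untwistD untwistZ; congr (_ + _).
have bF n : bilinear_map (fun u v => s d u *: f v n).
  exact: bilinear_map_scalel.
have bZ x : bilinear_map (fun v n => s d x *: f v n).
  by apply: linear_bilinear_map => // k u v; rewrite linearP.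
have eq_F := untwist_coassoc coalgC comodM bij_psi bij_omega bij_psiM m bF bZ.
transitivity (untwist omega psiM rho
    (fun x n => untwist omega psiM rho (fun u v => s d x *: f u v) n) m).
  by apply: eq_untwist => x y; rewrite linear_mapZ // untwistZ.
rewrite -eq_F; apply: eq_untwist => x y; apply: eq_untwist => u v.
by rewrite (linear_mapZ (fll y)).
Qed.

End RightSlice.

(** * Values of [eps] and [sigma] on slices *)

Let leps : linear (eps : C -> K^o).
Proof. by move=> a x y; rewrite linearP. Qed.

Lemma eps_left_slice c d : eps (L c d) = s c d - l1 * eps d * eps c.
Proof.
rewrite /left_slice linearB linearZ_LR /=; congr (_ - _).
rewrite (linear_untwistE leps) -{2}[c]untwist_counitl.
rewrite (linear_untwistE (sl d)); apply: (@eq_untwist _ _ _ _ _ _ K^o) => x y.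
by rewrite (linear_mapZ leps) (linear_mapZ (sl d)) /GRing.scale /= mulrC.
Qed.

Lemma eps_right_slice c d : eps (R c d) = s c d + l2 * eps c * eps d.
Proof.
rewrite /right_slice linearD linearZ_LR /=; congr (_ + _).
rewrite (linear_untwistE leps) -{2}[d]untwist_counitr.
rewrite (linear_untwistE (sr c)); apply: (@eq_untwist _ _ _ _ _ _ K^o) => x y.
by rewrite (linear_mapZ leps) (linear_mapZ (sr c)) /GRing.scale /= mulrC.
Qed.

Lemma linear_form_left_slice (f : C -> K^o) c d : linear f ->
  f (L c d) = cun (fun x y => s y d *: f x) c - l1 * eps d * f c.
Proof.
move=> lf; rewrite /left_slice (linear_mapB lf) (linear_mapZ lf); congr (_ - _).
rewrite (linear_untwistE lf); apply: (@eq_untwist _ _ _ _ _ _ K^o) => x y.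
by rewrite (linear_mapZ lf).
Qed.

Lemma linear_form_right_slice (f : C -> K^o) c d : linear f ->
  f (R c d) = cun (fun x y => s c x *: f y) d + l2 * eps c * f d.
Proof.
move=> lf; rewrite /right_slice (linear_mapD lf) (linear_mapZ lf).
congr (_ + _).
rewrite (linear_untwistE lf); apply: (@eq_untwist _ _ _ _ _ _ K^o) => x y.
by rewrite (linear_mapZ lf).
Qed.

Let lsa e : linear (fun c => s (alpha c) (beta e)).
Proof. by move=> a x y; rewrite linearP sl. Qed.
Let lsb c : linear (fun e => s (alpha c) (beta e)).
Proof. by move=> a x y; rewrite linearP sr. Qed.

(** The axiom for [sigma] freed of [psi] and [omega]: in each sum, invariance of [sigma] under these
    maps absorbs them into the inverse twists. *)
Lemma untwist_sigma c d e :
  cun (fun x y => s y d *: (s (alpha x) (beta e) : K^o)) c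
  - cun (fun x y => s c x *: (s y e : K^o)) d
  + cun (fun x y => s d x *: (s (alpha c) (beta y) : K^o)) e
  = (l1 - l2) * s (alpha c) (beta e) * eps d.
Proof.
have sw : forall c d, s (omega c) (omega d) = s c d.
  by move=> *; apply: sigma_pure_invariant; apply: cqt_sigma_omega cqtC.
have sp : forall c d, s (psi c) (psi d) = s c d.
  by move=> *; apply: sigma_pure_invariant; apply: cqt_sigma_psi cqtC.
rewrite -[RHS](cqt_sigma cqtC); congr (_ - _ + _); apply: eq_sweedler => x y.
- rewrite -[s (inverse _ _) _]sp -[s (alpha _) _]sw /GRing.scale /= mulrC.
  by rewrite -(cqt_alpha_omega cqtC) -(cqt_beta_omega cqtC) !Kinverse.
- rewrite -[s c _]sw -[s (inverse _ _) _]sp /GRing.scale /=.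
  by rewrite !Kinverse.
- rewrite -[s d _]sw -[s (alpha _) _]sp /GRing.scale /=.
  by rewrite -(cqt_alpha_psi cqtC) -(cqt_beta_psi cqtC) !Kinverse.
Qed.

(** The counit terms of the first and third slices add up to minus the right side of the axiom,
    whose constant is l1 - l2; only the counit term of the middle slice survives. Here the middle
    sum sigma(c, d_1) sigma(d_2, e) is read as a contraction of d_2 with e; [sigma_slice_right]
    reads it as a contraction of d_1 with c. *)
Lemma sigma_slice_left c d e :
  s (alpha (L c d)) (beta e) - s c (L d e) + s (alpha c) (beta (R d e)) =
  l1 * eps e * s c d.
Proof.
have := untwist_sigma c d e.
have -> : cun (fun x y => s c x *: (s y e : K^o)) d =
    cun (fun x y => s y e *: (s c x : K^o)) d.
  by apply: eq_untwist => x y; rewrite /GRing.scale /= mulrC.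
rewrite (linear_form_left_slice _ _ (lsa e)).
rewrite (linear_form_left_slice d e (sr c)).
rewrite (linear_form_right_slice _ _ (lsb c)).
move: (cun _ c) (cun _ d) (cun _ e) => u v w eq_uvw.
have {}eq_uvw : (u : K) = (l1 - l2) * s (alpha c) (beta e) * eps d + v - w.
  by rewrite -eq_uvw; ring.
rewrite eq_uvw; ring.
Qed.

Lemma sigma_slice_right c d e :
  s (alpha (L c d)) (beta e) - s (R c d) e + s (alpha c) (beta (R d e)) =
  - (l2 * eps c * s d e).
Proof.
have := untwist_sigma c d e.
rewrite (linear_form_left_slice _ _ (lsa e)).
rewrite (linear_form_right_slice c d (sl e)).
rewrite (linear_form_right_slice _ _ (lsb c)).
move: (cun _ c) (cun _ d) (cun _ e) => u v w eq_uvw.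
have {}eq_uvw : (u : K) = (l1 - l2) * s (alpha c) (beta e) * eps d + v - w.
  by rewrite -eq_uvw; ring.
rewrite eq_uvw; ring.
Qed.

(** * Commutation and Yang-Baxter-type identities for slices *)

Let endo_alpha : coquasitriangular_endo alpha.
Proof. by case: cqtC => *; split=> // c; rewrite -?cqt_alpha_Delta. Qed.
Let endo_beta : coquasitriangular_endo beta.
Proof. by case: cqtC => *; split=> // c; rewrite -?cqt_beta_Delta. Qed.
Let endo_psi : coquasitriangular_endo psi.
Proof. by case: cqtC => -[[*] *]; split. Qed.
Let endo_omega : coquasitriangular_endo omega.
Proof. by case: cqtC => -[[*] *]; split. Qed.

Let R_endo (g : {linear C -> C}) c d :
  coquasitriangular_endo g -> g (R c d) = R (g c) (g d).
Proof. by move=> endo_g; apply: right_slice_endo => //; case: endo_g. Qed.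

Lemma left_sliceE c d :
  L c d = cun (fun x y => s y d *: x) c - (l1 * eps d) *: c.
Proof. by []. Qed.

(** L(-, e) contracts the last leg of the coproduct of d and R(c, -) the first, so the two
    operations commute. *)
Lemma slices_assoc c d e : L (R c d) e = R c (L d e).
Proof.
rewrite left_sliceE (untwist_right_slice comodC bij_psi) //; last first.
  exact: bilinear_map_scaler.
rewrite (left_sliceE d e) (bilinear_mapBr bR) (bilinear_mapZr bR).
rewrite (linear_untwistE (proj2 bR c)); congr (_ - _).
by apply: eq_untwist => x y; rewrite (bilinear_mapZr bR).
Qed.

(** Apply [sigma_slice_left] to the last leg of the coproduct of c. What remains after the counit
    terms are collected is -l1 l2 eps(d) eps(e) alpha(c), which is zero since l1 l2 = 0. *)
Lemma left_slice_yang_baxter c d e :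
  L (alpha (L c d)) (beta e) - alpha (L c (L d e))
  + L (alpha c) (beta (R d e)) = 0.
Proof.
have bxs u : bilinear_map (fun x y => s y u *: x) by exact: bilinear_map_scaler.
have bas u : bilinear_map (fun x y => s (alpha y) u *: alpha x).
  apply: bilinear_map_scaler; last exact: linearP.
  by move=> a x y; rewrite linearP sl.
have -> : alpha (L c (L d e)) =
    cun (fun x y => s y (L d e) *: alpha x) c - (l1 * eps (L d e)) *: alpha c.
  rewrite (left_sliceE c) linearB linearZ_LR (linear_untwistE (linearP alpha)).
  by congr (_ - _); apply: eq_untwist => x y; rewrite linearZ_LR.
rewrite (left_sliceE (alpha _) (beta e)) (left_sliceE (alpha c)).
rewrite !untwist_endo // untwist_left_slice // !opprD !opprK.
(* Terms 1, 3, 5 are the contraction sums, term 2 is the multiple of [alpha (L c d)], and terms 4, 6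
   are multiples of [alpha c]. *)
rewrite (AC ((2*2)*2) ((1*3*5)*2*(4*6))) /= -untwistB -untwistD.
have -> : cun (fun x y => s (alpha (L y d)) (beta e) *: alpha x
      - s y (L d e) *: alpha x + s (alpha y) (beta (R d e)) *: alpha x) c =
    (l1 * eps e) *: alpha ((l1 * eps d) *: c + L c d).
  rewrite addrC subrK (linear_untwistE (linearP alpha)) -untwistZ.
  apply: eq_untwist => x y; rewrite -scalerBl -scalerDl sigma_slice_left.
  by rewrite linearZ_LR scalerA.
rewrite !(cqt_eps_beta cqtC) linearD linearZ_LR scalerDr addrK.
rewrite scalerA -scaleNr -!scalerDl -[RHS](scale0r (alpha c)); congr (_ *: _).
rewrite eps_left_slice eps_right_slice.
transitivity (- (l1 * l2) * eps d * eps e); first by ring.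
by rewrite l12 oppr0 !mul0r.
Qed.

(** * The product built from slices *)

Definition slice_mul (c d : C) : C := alpha (L c d) - beta (R c d).

Lemma slice_mul_bilinear : bilinear_map slice_mul.
Proof.
by apply: bilinear_mapB; apply: linear_bilinear_map => //; apply: linearP.
Qed.

Lemma slice_mul_endo (g : {linear C -> C}) c d :
  coquasitriangular_endo g -> (forall c, g (alpha c) = alpha (g c)) ->
  (forall c, g (beta c) = beta (g c)) ->
  g (slice_mul c d) = slice_mul (g c) (g d).
Proof.
move=> endo_g ga gb; rewrite /slice_mul linearB /= ga gb.
by rewrite left_slice_endo // R_endo.
Qed.

(** * The action of C on a comodule and its coaction *)

Section HopfModule.
Variables (M : lmodType K) (rho : {linear M -> tensor C M})
  (psiM omegaM betaM : {linear M -> M}).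
Hypotheses (comodM : left_comodule Delta psi omega rho psiM omegaM)
  (bij_psiM : bijective psiM)
  (beta_psiM : forall m, betaM (psiM m) = psiM (betaM m))
  (rho_betaM : forall m, rho (betaM m) = tensor_map beta betaM (rho m)).

Local Notation un := (untwist omega psiM rho).
Local Notation RM := (right_slice rho psiM).

(** Apply [sigma_slice_right] to the C-leg of the coaction; the remaining multiple of [betaM m] has
    coefficient -l1 l2 eps(c) eps(d) = 0. *)
Lemma right_slice_yang_baxter c d m :
  RM (alpha (L c d)) (betaM m) - betaM (RM (R c d) m)
  + RM (alpha c) (betaM (RM d m)) = 0.
Proof.
have RME c' m' :
    RM c' m' = un (fun x n => s c' x *: n) m' + (l2 * eps c') *: m'.
  by [].
have bsn u : bilinear_map (fun x n => s u x *: n : M).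
  exact: bilinear_map_scalel.
have bbn u : bilinear_map (fun x n => s u (beta x) *: betaM n).
  apply: bilinear_map_scalel; last exact: linearP.
  by move=> a x y; rewrite linearP sr.
have betaRM c' : betaM (RM c' m) =
    un (fun x n => s c' x *: betaM n) m + (l2 * eps c') *: betaM m.
  rewrite RME linearD linearZ_LR (linear_untwistE (linearP betaM)).
  by congr (_ + _); apply: eq_untwist => x n; rewrite linearZ_LR.
have [_ beta_omega _ _ _] := endo_beta.
have un_beta u m' : un (fun x n => s u x *: n) (betaM m') =
    un (fun x n => s u (beta x) *: betaM n) m'.
  exact: untwist_morph.
rewrite (RME (alpha (L c d))) (RME (alpha c)) !un_beta.
rewrite (untwist_right_slice comodM) // !betaRM scalerDr !opprD.
(* Terms 1, 3, 5 combine through [sigma_slice_right] into a sum that cancels term 6; terms 2, 4, 7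
   are multiples of [betaM m]. *)
rewrite (AC ((2*2)*(1*2)) ((1*3*5)*6*(2*4*7))) /= -untwistB -untwistD.
have -> : un (fun x n => s (alpha (L c d)) (beta x) *: betaM n
      - s (R c d) x *: betaM n + s (alpha c) (beta (R d x)) *: betaM n) m =
    - (l2 * eps c) *: un (fun x n => s d x *: betaM n) m.
  rewrite -untwistZ; apply: eq_untwist => x n.
  by rewrite -scalerBl -scalerDl sigma_slice_right scalerA mulNr.
rewrite !(cqt_eps_alpha cqtC) scaleNr addNr add0r.
rewrite scalerA -scaleNr -!scalerDl -[RHS](scale0r (betaM m)); congr (_ *: _).
rewrite eps_left_slice eps_right_slice.
transitivity (- (l1 * l2) * eps c * eps d); first by ring.
by rewrite l12 oppr0 !mul0r.
Qed.

Lemma right_slice_sweedlerE c m :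
  betaM (RM c m) =
  \sw_(m1 ⊗ m0 <- rho m) (sigma (omega c ⊗ m1) *: betaM (inverse psiM m0))
  + (l2 * eps c) *: betaM m.
Proof.
rewrite /right_slice linearD linearZ_LR (linear_untwistE (linearP betaM)).
congr (_ + _); apply: eq_sweedler => x n.
have [_ _ _ _ sigma_omega] := endo_omega.
by rewrite linearZ_LR -(sigma_pure_invariant _ _ sigma_omega) Kinverse.
Qed.

(** The R-part of the product in the first sum is already the left side, since R(c, -) acts on the
    C-leg of the coaction. The L-part cancels the other two terms by
    [untwist_left_slice_coaction]. *)
Lemma coaction_right_slice c m :
  (l1 != 0 -> forall m, \sw_(m1 ⊗ m0 <- rho m) (eps m1 *: m0) = psiM m) ->
  rho (- betaM (RM c m)) =
  \sw_(x ⊗ n <- rho m) (slice_mul (omega c) x ⊗ betaM n)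
  + \sw_(x ⊗ y <- Delta c) (alpha x ⊗ - betaM (RM y (psiM m)))
  + (l1 + l2) *: (alpha (omega c) ⊗ betaM (psiM m)).
Proof.
move=> counitM.
have bp N N' := pure_bilinear N N' (K := K).
have bwp : bilinear_map (fun x n => omega x ⊗ psiM n).
  by apply: bilinear_map_comp => //; apply: linearP.
have bwbp : bilinear_map (fun x n => omega (beta x) ⊗ betaM (psiM n)).
  apply: (bilinear_map_comp (h := betaM \o psiM) (bp _ _)) => a x y;
    by rewrite /= !linearP.
have bwap : bilinear_map (fun x n => omega (alpha x) ⊗ betaM (psiM n)).
  apply: (bilinear_map_comp (h := betaM \o psiM) (bp _ _)) => a x y;
    by rewrite /= !linearP.
have [_ beta_omega _ _ _] := endo_beta.
have [_ alpha_omega _ _ _] := endo_alpha.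
rewrite linearN /= -[rho (betaM _)](untwist_pure rho bij_omega bij_psiM).
rewrite (untwist_morph bij_omega bij_psiM (g := beta) (h := betaM)) //.
have -> : un (fun x n => omega (beta x) ⊗ psiM (betaM n)) (RM c m) =
    un (fun x n => omega (beta (R c x)) ⊗ betaM (psiM n)) m.
  rewrite -(untwist_right_slice comodM bij_psiM c m bwbp).
  by apply: eq_untwist => x n; rewrite beta_psiM.
have -> : \sw_(x ⊗ n <- rho m) (slice_mul (omega c) x ⊗ betaM n) =
    un (fun x n => omega (alpha (L c x)) ⊗ betaM (psiM n)) m
    - un (fun x n => omega (beta (R c x)) ⊗ betaM (psiM n)) m.
  rewrite -untwistB; apply: eq_sweedler => x n.
  rewrite -{1}[x](Kinverse bij_omega) -(slice_mul_endo (g := omega)) //.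
  rewrite Kinverse // /slice_mul linearB /=.
  by rewrite -(bilinear_mapBl (bp _ _)).
have -> : \sw_(x ⊗ y <- Delta c) (alpha x ⊗ - betaM (RM y (psiM m))) =
    - cun (fun x y => omega (alpha x) ⊗ betaM (psiM (RM y m))) c.
  rewrite -[RHS]scaleN1r -untwistZ; apply: eq_sweedler => x y.
  rewrite (right_slice_endo bij_psiM (g := psi) (h := psiM)) //; last first.
    exact: lc_psi comodM.
  rewrite -alpha_omega !Kinverse // scaleN1r.
  by rewrite -scaleN1r (bilinear_mapZr (bp _ _)) scaleN1r.
have := untwist_left_slice_coaction bij_psiM c m counitM bwap => /= ->.
by rewrite -alpha_omega (AC (3*1*1) (3*(1*4)*(2*5))) /= subrr addNr !addr0.
Qed.

End HopfModule.

(** In the associativity law the mixed terms agree by [slices_assoc], and the rest is the pair of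
    Yang-Baxter-type identities, with C as a comodule over itself in the second. *)
Lemma slice_mul_bialgebra :
  infBH_bialgebra (l1 + l2) slice_mul Delta alpha beta psi omega.
Proof.
have [[cob _ _ _ eps_psi] _ _ ab ap ao bp bo aD bD _ _ _ _ _ _ _] := cqtC.
have rD c : Delta (beta c) = tensor_map beta beta (Delta c) by rewrite bD.
split=> // [|c d|c d|c d]; try exact: slice_mul_endo.
- split=> // [|c d|c d|c d e]; try exact: slice_mul_endo.
    exact: slice_mul_bilinear.
  rewrite /slice_mul !(bilinear_mapBl bL) !(bilinear_mapBr bL).
  rewrite !(bilinear_mapBl bR) !(bilinear_mapBr bR).
  rewrite -!left_slice_endo // -!R_endo // slices_assoc.
  have /eqP := right_slice_yang_baxter comodC bij_psi bp rD c d e.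
  rewrite addr_eq0 => /eqP ->.
  have /eqP := left_slice_yang_baxter c d e.
  rewrite -addrA [- _ + _]addrC addr_eq0 opprB => /eqP ->.
  move: (L c _) (L (alpha c) _) (R c _) (R (alpha c) _) => u v w z.
  by rewrite !linearB linearN /= ab addrA.
(* The coproduct of -beta R(c, d) comes from the coaction formula on C itself; adding that of alpha
   L(c, d), which is the sum of alpha(c_1) ⊗ alpha L(c_2, psi(d)), completes the second legs to
   products. *)
have := coaction_right_slice comodC bij_psi bp rD c d
  (fun _ => cbhc_counitl (cqt_coalgebra cqtC)).
rewrite {2}/slice_mul [Delta (alpha _ - _)]linearD /= => ->.
have [bp1 bp2] := pure_bilinear C C.
have baL : bilinear_map (fun x y => omega x ⊗ psi y).
  by apply: (bilinear_map_comp (pure_bilinear C C)); apply: linearP.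
rewrite -[Delta (alpha _)](untwist_pure Delta bij_omega bij_psi).
rewrite untwist_endo // untwist_left_slice; last first.
  by apply: (bilinear_map_comp (g := omega \o alpha) (h := psi \o alpha)
    (pure_bilinear C C)) => a x y; rewrite /= !linearP.
rewrite addrA; congr (_ + _); rewrite addrCA; congr (_ + _).
rewrite /untwist /sweedler -big_split; apply: eq_bigr => q _ /=.
rewrite -ao -ap left_slice_endo // !Kinverse //.
by rewrite -(bilinear_mapDr (pure_bilinear C C)).
Qed.

(** * Assembly of the Hopf module and comparison with the explicit formulas *)

Section Conclusion.
Variables (M : lmodType K) (rho : {linear M -> tensor C M})
  (alphaM betaM psiM omegaM : {linear M -> M}).

Lemma right_slice_Hopf_module :
  left_comodule Delta psi omega rho psiM omegaM ->
  (l1 != 0 -> forall m, \sw_(m1 ⊗ m0 <- rho m) (eps m1 *: m0) = psiM m) ->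
  bijective psiM ->
  (forall m, betaM (psiM m) = psiM (betaM m)) ->
  (forall m, rho (betaM m) = tensor_map beta betaM (rho m)) ->
  (forall m, alphaM (betaM m) = betaM (alphaM m)) ->
  (forall m, alphaM (psiM m) = psiM (alphaM m)) ->
  (forall m, alphaM (omegaM m) = omegaM (alphaM m)) ->
  (forall m, betaM (omegaM m) = omegaM (betaM m)) ->
  (forall m, rho (alphaM m) = tensor_map alpha alphaM (rho m)) ->
  infBH_Hopf_module (l1 + l2) slice_mul Delta alpha beta psi omega
    (fun c m => - betaM (right_slice rho psiM c m)) rho alphaM betaM psiM omegaM.
Proof.
move=> comodM counitM bij_psiM bp rb ab ap ao bo ra.
have bR' := right_slice_bilinear rho bij_psiM.
split=> //; first exact: slice_mul_bialgebra.
- split=> // [|c m|c m|c d m].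
  + by apply: (linear_bilinear_map (g := \- betaM) bR') => a x y;
      rewrite /= linearP opprD scalerN.
  + by rewrite linearN /= ab (right_slice_endo bij_psiM (g := alpha)).
  + by rewrite linearN /= (right_slice_endo bij_psiM (g := beta)).
  (* With the product expanded as alpha L - beta R and equivariance under beta, this identity is the
     module law up to sign and an outer [betaM]. *)
  have := right_slice_yang_baxter comodM bij_psiM bp rb c d m.
  rewrite /slice_mul (bilinear_mapBl bR') => /eqP.
  rewrite -(right_slice_endo bij_psiM (g := beta) (h := betaM) (R c d)) //.
  rewrite addr_eq0 => /eqP ->; rewrite linearN opprK.
  by rewrite -[- betaM (_ d m)]scaleN1r (bilinear_mapZr bR') scaleN1r linearN
    opprK.
- exact: lc_comm comodM.
- by move=> c m; apply: (coaction_right_slice comodM).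
Qed.

End Conclusion.
Lemma slice_mul_sweedlerE c d :
  slice_mul c d =
  \sw_(c1 ⊗ c2 <- Delta c) (sigma (c2 ⊗ psi d) *: alpha (inverse omega c1))
  - \sw_(d1 ⊗ d2 <- Delta d) (sigma (omega c ⊗ d1) *: beta (inverse psi d2))
  - (l1 * eps d) *: alpha c - (l2 * eps c) *: beta d.
Proof.
rewrite /slice_mul right_slice_sweedlerE /left_slice linearB linearZ_LR /=.
rewrite (linear_untwistE (linearP alpha)) opprD addrA; congr (_ - _).
rewrite addrAC; congr (_ - _ - _); apply: eq_sweedler => x y.
have [_ _ _ _ sigma_psi] := endo_psi.
by rewrite linearZ_LR -(sigma_pure_invariant _ _ sigma_psi) Kinverse.
Qed.

End Coquasitriangular.

(** The commutation relations among the four maps of M are clauses of the Hopf module structure, and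
    compatibility of [rho] with [alphaM] makes the action equivariant under alpha. The counit
    identity in part (1) handles the term with l1 = lam. *)
Theorem theorem3p36 (K : fieldType) (lam : K) :
  (forall (C : lmodType K) (Delta : {linear C -> tensor C C})
      (eps : {scalar C}) (alphaC betaC psiC omegaC : {linear C -> C})
      (sigma : {scalar (tensor C C)})
      (M : lmodType K) (rho : {linear M -> tensor C M})
      (alphaM betaM psiM omegaM : {linear M -> M}),
    coquasitriangular lam Delta eps alphaC betaC psiC omegaC sigma ->
    left_comodule Delta psiC omegaC rho psiM omegaM ->
    (lam != 0 -> forall m, \sw_(m1 ⊗ m0 <- rho m) (eps m1 *: m0) = psiM m) ->
    bijective psiM ->
    (forall m, betaM (psiM m) = psiM (betaM m)) ->
    (forall m, rho (betaM m) = tensor_map betaC betaM (rho m)) ->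
    (forall m, alphaM (betaM m) = betaM (alphaM m)) ->
    (forall m, alphaM (psiM m) = psiM (alphaM m)) ->
    (forall m, alphaM (omegaM m) = omegaM (alphaM m)) ->
    (forall m, betaM (omegaM m) = omegaM (betaM m)) ->
    (forall m, rho (alphaM m) = tensor_map alphaC alphaM (rho m)) ->
    infBH_Hopf_module lam
      (mu_sigma lam Delta eps alphaC betaC psiC omegaC sigma)
      Delta alphaC betaC psiC omegaC
      (fun c m =>
         - (\sw_(m1 ⊗ m0 <- rho m)
              (sigma (omegaC c ⊗ m1) *: betaM (inverse psiM m0))))
      rho alphaM betaM psiM omegaM)
  /\
  (forall (C : lmodType K) (Delta : {linear C -> tensor C C})
      (eps : {scalar C}) (alphaC betaC psiC omegaC : {linear C -> C})
      (sigma : {scalar (tensor C C)})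
      (M : lmodType K) (rho : {linear M -> tensor C M})
      (alphaM betaM psiM omegaM : {linear M -> M}),
    anti_coquasitriangular lam Delta eps alphaC betaC psiC omegaC sigma ->
    left_comodule Delta psiC omegaC rho psiM omegaM ->
    bijective psiM ->
    (forall m, betaM (psiM m) = psiM (betaM m)) ->
    (forall m, rho (betaM m) = tensor_map betaC betaM (rho m)) ->
    (forall m, alphaM (betaM m) = betaM (alphaM m)) ->
    (forall m, alphaM (psiM m) = psiM (alphaM m)) ->
    (forall m, alphaM (omegaM m) = omegaM (alphaM m)) ->
    (forall m, betaM (omegaM m) = omegaM (betaM m)) ->
    (forall m, rho (alphaM m) = tensor_map alphaC alphaM (rho m)) ->
    infBH_Hopf_module lam
      (mu_sigma_tilde lam Delta eps alphaC betaC psiC omegaC sigma)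
      Delta alphaC betaC psiC omegaC
      (fun c m =>
         - (\sw_(m1 ⊗ m0 <- rho m)
              (sigma (omegaC c ⊗ m1) *: betaM (inverse psiM m0)))
         - (lam * eps c) *: betaM m)
      rho alphaM betaM psiM omegaM).
Proof.
split=> C Delta eps alphaC betaC psiC omegaC sigma M rho alphaM betaM psiM omegaM.
(* Here (l1, l2) = (lam, 0), and kappa = lam is written as lam - 0. *)
- rewrite /coquasitriangular -{1}[lam]subr0.
  move=> cqtC comodM counitM bij_psiM bp rb ab ap ao bo ra.
  have := right_slice_Hopf_module (mulr0 lam) cqtC comodM counitM bij_psiM
    bp rb ab ap ao bo ra.
  rewrite addr0.
  have -> : slice_mul lam 0 Delta eps alphaC betaC psiC omegaC sigma =
      mu_sigma lam Delta eps alphaC betaC psiC omegaC sigma.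
    apply/funext => c; apply/funext => d.
    by rewrite (slice_mul_sweedlerE cqtC) mul0r scale0r subr0.
  congr (infBH_Hopf_module _ _ _ _ _ _ _ _ _ _ _ _ _).
  apply/funext => c; apply/funext => m.
  by rewrite (right_slice_sweedlerE cqtC) mul0r scale0r addr0.
(* Here (l1, l2) = (0, lam), and kappa = - lam is written as 0 - lam; the counit condition on M is
   then vacuous. *)
- rewrite /anti_coquasitriangular -sub0r.
  move=> cqtC comodM bij_psiM bp rb ab ap ao bo ra.
  have counitM : 0 != 0 :> K ->
      forall m, \sw_(m1 ⊗ m0 <- rho m) (eps m1 *: m0) = psiM m.
    by rewrite eqxx.
  have := right_slice_Hopf_module (mul0r lam) cqtC comodM counitM bij_psiM
    bp rb ab ap ao bo ra.
  rewrite add0r.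
  have -> : slice_mul 0 lam Delta eps alphaC betaC psiC omegaC sigma =
      mu_sigma_tilde lam Delta eps alphaC betaC psiC omegaC sigma.
    apply/funext => c; apply/funext => d.
    by rewrite (slice_mul_sweedlerE cqtC) mul0r scale0r subr0.
  congr (infBH_Hopf_module _ _ _ _ _ _ _ _ _ _ _ _ _).
  apply/funext => c; apply/funext => m.
  by rewrite (right_slice_sweedlerE cqtC) opprD.
Qed.
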